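(* Let $F\in\mathbb{R}^{3\times 3}$ with $\det[F]>0$, and let $F=USV^T$ be a singular value decomposition with $U,V\in\mathsf{SO(3)}$ and $S=\mathrm{diag}[s_1,s_2,s_3]$, $s_1,s_2,s_3>0$. Then the normalizing constant $c(F)$ of the matrix Fisher distribution on $\mathsf{SO(3)}$ with matrix parameter $F$ satisfies, for every $(i,j,k)\in\{(1,2,3),(2,3,1),(3,1,2)\}$, \[ c(F)=c(S)=\int_{-1}^{1}\frac12\, I_0\!\left[\tfrac12(s_i-s_j)(1-u)\right]\, I_0\!\left[\tfrac12(s_i+s_j)(1+u)\right]\exp(s_k u)\,du . \]
   Context: $\mathsf{SO(3)}=\{R\in\mathbb{R}^{3\times 3}\mid R^TR=I_{3\times 3},\ \det[R]=1\}$, and $dR$ denotes the Haar measure on $\mathsf{SO(3)}$ normalized so that $\int_{\mathsf{SO(3)}}dR=1$. The matrix Fisher distribution on $\mathsf{SO(3)}$ with matrix parameter $F\in\mathbb{R}^{3\times3}$, denoted $\mathcal{M}(F)$, has probability density $p(R)=\frac{1}{c(F)}\exp(\mathrm{tr}[F^TR])$ with respect to $dR$, where for any $A\in\mathbb{R}^{3\times 3}$ one sets $c(A)=\int_{\mathsf{SO(3)}}\exp(\mathrm{tr}[A^TR])\,dR$. $I_0$ is the modified Bessel function of the first kind of degree zero, $I_0(u)=\sum_{r=0}^\infty (\tfrac12 u)^{2r}/(r!)^2$. The singular values are not assumed to be listed in any particular order. *)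

(* Defs.v *)
From HB Require Import structures.
From mathcomp Require Import all_boot all_order all_algebra.
From mathcomp Require Import all_classical all_reals all_analysis.

Set Implicit Arguments.
Unset Strict Implicit.
Unset Printing Implicit Defensive.

Import Order.TTheory GRing.Theory Num.Theory.
Import numFieldNormedType.Exports.

Local Open Scope classical_set_scope.
Local Open Scope ring_scope.

Definition SO3_set (R : realType) : set 'M[R]_3 :=
  [set Q | Q^T *m Q = 1%:M /\ \det Q = 1].

Definition SO3 (R : realType) : Type := set_type (@SO3_set R).

Section SO3_group.
Variable R : realType.

(* The library gives [set_type] the subspace topology. *)
HB.instance Definition _ := Topological.copy (SO3 R) (set_type (@SO3_set R)).

Fact SO3_one_subproof : (1%:M : 'M[R]_3) \in @SO3_set R.
Proof. by apply/mem_set; split; rewrite ?trmx1 ?mulmx1 ?det1. Qed.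

Fact SO3_inv_subproof (A : SO3 R) : (\val A)^T \in @SO3_set R.
Proof.
have /set_mem[AA dA] := valP A.
by apply/mem_set; split; rewrite ?trmxK ?det_tr //; exact: mulmx1C.
Qed.

Fact SO3_mul_subproof (A B : SO3 R) : \val A *m \val B \in @SO3_set R.
Proof.
have /set_mem[AA dA] := valP A; have /set_mem[BB dB] := valP B.
apply/mem_set; split; last by rewrite det_mulmx dA dB mulr1.
by rewrite trmx_mul -mulmxA (mulmxA (\val A)^T) AA mul1mx.
Qed.

Definition SO3_one : SO3 R :=
  exist (fun Q => Q \in @SO3_set R) _ SO3_one_subproof.
Definition SO3_inv (A : SO3 R) : SO3 R :=
  exist (fun Q => Q \in @SO3_set R) _ (SO3_inv_subproof A).
Definition SO3_mul (A B : SO3 R) : SO3 R :=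
  exist (fun Q => Q \in @SO3_set R) _ (SO3_mul_subproof A B).

Fact SO3_mulA : associative SO3_mul.
Proof. by move=> A B C; apply/val_inj; exact: mulmxA. Qed.

Fact SO3_mul1g : left_id SO3_one SO3_mul.
Proof. by move=> A; apply/val_inj; exact: mul1mx. Qed.

Fact SO3_mulg1 : right_id SO3_one SO3_mul.
Proof. by move=> A; apply/val_inj; exact: mulmx1. Qed.

Fact SO3_mulVg : left_inverse SO3_one SO3_inv SO3_mul.
Proof. by move=> A; apply/val_inj => /=; have /set_mem[] := valP A. Qed.

Fact SO3_mulgV : right_inverse SO3_one SO3_inv SO3_mul.
Proof.
by move=> A; apply/val_inj => /=; apply: mulmx1C; have /set_mem[] := valP A.
Qed.

HB.instance Definition _ := isGroup.Build (SO3 R)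
  SO3_mulA SO3_mul1g SO3_mulg1 SO3_mulVg SO3_mulgV.

HB.instance Definition _ := isPointed.Build (SO3 R) (1%g : SO3 R).

End SO3_group.

Definition borelSO3 (R : realType) := g_sigma_algebraType (@open (SO3 R)).

(* The normalization of the Haar measure is part of the type of [mu].  Only left
   invariance is required.  Regularity is automatic, since SO(3) is a compact
   metric space. *)
Definition is_haar (R : realType) (mu : probability (borelSO3 R) R) : Prop :=
  forall (g : SO3 R) (A : set (SO3 R)), measurable (A : set (borelSO3 R)) ->
    mu ((fun h : SO3 R => (g * h)%g) @` A) = mu A.

(* The normalizing constant of the matrix Fisher distribution, whose density
   with respect to the Haar measure is exp(tr(A^T Q)) / c(A). *)
Definition fisher_const (R : realType) (mu : probability (borelSO3 R) R)
    (A : 'M[R]_3) : R :=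
  \int[mu]_Q expR (\tr (A^T *m \val (Q : SO3 R))).

Definition besselI0 (R : realType) (u : R) : R :=
  limn (series (fun r : nat => (u / 2) ^+ (2 * r) / (r`!%:R) ^+ 2)).

(* Main.v *)
(* A left invariant probability on SO(3) is invariant under inversion, hence
   bi-invariant; this gives c(F) = c(S).  Let the upper left 2x2 block of Q act
   on the plane as v |-> alpha v + beta (conjugate v).  Then
     tr (S Q) = (s1 + s2) Re alpha + (s1 - s2) Re beta + s3 Q33
   with |alpha| = (1 + Q33) / 2 and |beta| = (1 - Q33) / 2, and multiplying Q on
   both sides by rotations about the third axis rotates alpha and beta
   independently.  Comparing coefficients of order two in the rotation angle
   turns these invariances into recursions for moments: those of Re alpha and
   Re beta produce the coefficients of I0, and those of Q33 are the moments of
   the uniform distribution on [-1, 1].  So the identity holds exactly with the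
   three exponentials replaced by their Taylor polynomials and I0 by its partial
   sums, and dominated convergence passes to the limit on both sides. *)
Require Import Defs.
From HB Require Import structures.
From mathcomp Require Import all_boot all_order all_algebra.
From mathcomp Require Import all_classical all_reals all_analysis.
From mathcomp Require Import measurable_realfun ring lra.

Set Implicit Arguments.
Unset Strict Implicit.
Unset Printing Implicit Defensive.

Import Order.TTheory GRing.Theory Num.Theory.
Import numFieldNormedType.Exports.

Local Open Scope classical_set_scope.
Local Open Scope ring_scope.

(** * Test functions on SO(3) *)

Section test_functions.
Context {R : realType}.
Implicit Types (phi psi : 'M[R]_3 -> R) (A B Q : 'M[R]_3).

Lemma SO3_set1 : SO3_set (1%:M : 'M[R]_3).
Proof. by split; rewrite ?trmx1 ?mulmx1 ?det1. Qed.

Lemma SO3_setM A B : SO3_set A -> SO3_set B -> SO3_set (A *m B).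
Proof.
move=> [AA dA] [BB dB]; split; last by rewrite det_mulmx dA dB mulr1.
by rewrite trmx_mul -mulmxA (mulmxA A^T) AA mul1mx.
Qed.

Lemma SO3_setT A : SO3_set A -> SO3_set A^T.
Proof.
by move=> [AA dA]; split; rewrite ?trmxK ?det_tr //; exact: mulmx1C.
Qed.

Lemma SO3_val (Q : SO3 R) : SO3_set (\val Q).
Proof. exact: set_mem (valP Q). Qed.

(** Each column of Q is a unit vector, so the square of one entry is at most the whole sum 1. *)
Lemma SO3_set_entry Q i j : SO3_set Q -> `|Q i j| <= 1.
Proof.
move=> [QQ _]; have /matrixP/(_ j j) := QQ.
rewrite !mxE eqxx /= mulr1n (bigD1 i) //= mxE => e.
rewrite -(@ler_pXn2r R 2) ?nnegrE // expr1n -normrX ger0_norm ?sqr_ge0 //.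
rewrite expr2 -[leRHS]e lerDl.
by apply: sumr_ge0 => k _; rewrite mxE -expr2 sqr_ge0.
Qed.

(* Measurability is demanded after composition with an arbitrary matrix-valued
   map, so that [phi (g^T *m h)] is jointly measurable in (g, h) without
   identifying the Borel sigma-algebra of a product. *)
Definition test_fun phi :=
  (forall d (T : measurableType d) (M : T -> 'M[R]_3),
     (forall i j, measurable_fun setT (fun t => M t i j)) ->
     measurable_fun setT (phi \o M)) /\
  exists C, forall Q, SO3_set Q -> `|phi Q| <= C.

Lemma test_fun_cst (c : R) : test_fun (fun=> c).
Proof. by split; [move=> *; exact: measurable_cst|exists `|c|]. Qed.

Lemma test_fun_entry i j : test_fun (fun Q => Q i j).
Proof.
split; first by move=> d T M; exact.
by exists 1 => Q; exact: SO3_set_entry.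
Qed.

Lemma test_funD phi psi :
  test_fun phi -> test_fun psi -> test_fun (fun Q => phi Q + psi Q).
Proof.
move=> [m1 [C1 b1]] [m2 [C2 b2]]; split => [d T M mM|].
  by apply: measurable_funD; [exact: m1|exact: m2].
exists (C1 + C2) => Q SQ; apply: le_trans (ler_normD _ _) _.
by rewrite lerD ?b1 ?b2.
Qed.

Lemma test_funM phi psi :
  test_fun phi -> test_fun psi -> test_fun (fun Q => phi Q * psi Q).
Proof.
move=> [m1 [C1 b1]] [m2 [C2 b2]]; split => [d T M mM|].
  by apply: measurable_funM; [exact: m1|exact: m2].
by exists (C1 * C2) => Q SQ; rewrite normrM ler_pM ?b1 ?b2.
Qed.

Lemma test_funX phi n : test_fun phi -> test_fun (fun Q => phi Q ^+ n).
Proof.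
move=> tphi; elim: n => [|n IH].
  by under eq_fun do rewrite expr0; exact: test_fun_cst.
by under eq_fun do rewrite exprS; exact: test_funM.
Qed.

Lemma test_funZ (c : R) phi : test_fun phi -> test_fun (fun Q => c * phi Q).
Proof. by move=> ?; apply: test_funM => //; exact: test_fun_cst. Qed.

Lemma test_funN phi : test_fun phi -> test_fun (fun Q => - phi Q).
Proof. by under eq_fun do rewrite -mulN1r; exact: test_funZ. Qed.

Lemma test_fun_sum (I : Type) (r : seq I) (P : pred I)
    (F : I -> 'M[R]_3 -> R) :
  (forall i, test_fun (F i)) -> test_fun (fun Q => \sum_(i <- r | P i) F i Q).
Proof.
move=> tF; elim: r => [|i r IH].
  by under eq_fun do rewrite big_nil; exact: test_fun_cst.
under eq_fun do rewrite big_cons.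
by case: (P i) => //; exact: test_funD.
Qed.

Lemma test_fun_expR phi : test_fun phi -> test_fun (fun Q => expR (phi Q)).
Proof.
move=> [m [C b]]; split => [d T M mM|].
  by apply: measurableT_comp; [exact: measurable_expR|exact: m].
exists (expR C) => Q SQ; rewrite ger0_norm ?expR_ge0 // ler_expR.
exact: le_trans (ler_norm _) (b _ SQ).
Qed.

Lemma mulmx_entry_measurable d (T : measurableType d) (M N : T -> 'M[R]_3) :
  (forall i j, measurable_fun setT (fun t => M t i j)) ->
  (forall i j, measurable_fun setT (fun t => N t i j)) ->
  forall i j, measurable_fun setT (fun t => (M t *m N t) i j).
Proof.
move=> mM mN i j; under eq_fun do rewrite mxE.
by apply: measurable_sum => k; exact: measurable_funM.
Qed.

Lemma test_fun_translate A B phi : SO3_set A -> SO3_set B ->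
  test_fun phi -> test_fun (fun Q => phi (A *m Q *m B)).
Proof.
move=> SA SB [m [C b]]; split; last first.
  by exists C => Q SQ; apply: b; do 2 apply: SO3_setM => //.
move=> d T M mM; apply: (m _ _ (fun t => A *m M t *m B)) => i j.
have cst N k l : measurable_fun [set: T] (fun=> N k l : R).
  exact: measurable_cst.
apply: (@mulmx_entry_measurable _ _ (fun t => A *m M t) (fun=> B)) => //.
exact: (@mulmx_entry_measurable _ _ (fun=> A) M).
Qed.

Lemma test_fun_tr phi : test_fun phi -> test_fun (fun Q => phi Q^T).
Proof.
move=> [m [C b]]; split; last by exists C => Q /SO3_setT; exact: b.
move=> d T M mM; apply: (m _ _ (fun t => (M t)^T)) => i j.
rewrite (_ : (fun t => _) = fun t => M t j i) //.
by apply/funext => t; rewrite mxE.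
Qed.

(** A neighbourhood of a matrix contains a product of neighbourhoods of its finitely many
    entries. *)
Lemma mx_entry_continuous (T : topologicalType) m n (f : T -> 'M[R]_(m, n)) :
  (forall i j, continuous (fun x => f x i j)) -> continuous f.
Proof.
move=> cf x U [P nP sPU]; rewrite nbhs_simpl /=.
apply: (@filterS _ (nbhs x) _ [set y | forall i j, P i j (f y i j)]).
  by move=> y; exact: sPU.
by apply: filter_forall => i; apply: filter_forall => j; apply: cf; exact: nP.
Qed.

Lemma SO3_val_continuous : continuous (fun Q : SO3 R => \val Q : 'M[R]_3).
Proof. exact: initial_continuous. Qed.

Lemma SO3_entry_continuous i j : continuous (fun Q : SO3 R => (\val Q) i j).
Proof.
move=> Q; apply: (@continuous_comp _ _ _ (fun Q : SO3 R => \val Q : 'M[R]_3)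
  (fun M : 'M[R]_3 => M i j)).
  exact: SO3_val_continuous.
exact: coord_continuous.
Qed.

Lemma SO3_entry_measurable i j :
  measurable_fun setT (fun Q : borelSO3 R => (\val (Q : SO3 R)) i j).
Proof.
apply: (measurability _ (RGenOpens.measurableE R)).
move=> _ [_ [a [b ->]] <-]; rewrite setTI; apply: sub_sigma_algebra.
apply: (open_comp _ (interval_open _ _ )) => //.
by move=> Q _; exact: SO3_entry_continuous.
Qed.

Lemma SO3_mull_continuous (g : SO3 R) : continuous (fun h : SO3 R => (g * h)%g).
Proof.
apply/continuousP => _ [V oV <-].
(* Open sets of the initial topology are preimages of open sets of matrices, so continuity of the
   matrix-valued product suffices. *)
have -> : (fun h : SO3 R => (g * h)%g) @^-1` (set_val @^-1` V) =
          (fun h : SO3 R => \val g *m \val h : 'M[R]_3) @^-1` V by [].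
suff /continuousP : continuous (fun h : SO3 R => \val g *m \val h : 'M[R]_3).
  by apply.
apply: mx_entry_continuous => i j.
under eq_fun do rewrite mxE.
have c k : continuous (fun h : SO3 R => (\val g) i k * (\val h) k j).
  move=> h; apply: (@continuousM _ (SO3 R) (fun=> (\val g) i k)
    (fun h : SO3 R => (\val h) k j)); first exact: cst_continuous.
  exact: SO3_entry_continuous.
exact: (@continuous_big _ _ _ 0 xpredT (@add_continuous R) _ (index_enum 'I_3)
  (fun k (h : SO3 R) => (\val g) i k * (\val h) k j) (fun k _ => c k)).
Qed.

Lemma SO3_mull_measurable (g : SO3 R) :
  measurable_fun setT (fun h : borelSO3 R => (g * h)%g : borelSO3 R).
Proof.
apply: (@measurability _ _ (borelSO3 R) (borelSO3 R) setT _ (@open (SO3 R)) erefl).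
move=> _ [V oV <-]; rewrite setTI; apply: sub_sigma_algebra.
by have /continuousP := @SO3_mull_continuous g; exact.
Qed.

End test_functions.

(** * Invariance of the Haar mean *)

Section haar_expectation.
Context {R : realType} (mu : probability (borelSO3 R) R).
Hypothesis mu_haar : is_haar mu.
Implicit Types (phi psi : 'M[R]_3 -> R) (A B Q : 'M[R]_3).

Definition expect phi : R := \int[mu]_Q phi (\val (Q : SO3 R)).

Lemma test_fun_measurable phi : test_fun phi ->
  measurable_fun setT (fun Q : borelSO3 R => phi (\val (Q : SO3 R))).
Proof.
by move=> [m _]; apply: m => i j; exact: SO3_entry_measurable.
Qed.

Lemma test_fun_integrable phi : test_fun phi ->
  mu.-integrable setT (EFin \o (fun Q : borelSO3 R => phi (\val (Q : SO3 R)))).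
Proof.
move=> tphi; apply: measurable_bounded_integrable => //.
- by rewrite (le_lt_trans (probability_le1 _ _)) ?ltry.
- exact: test_fun_measurable.
have [_ [C b]] := tphi; exists C; split; first exact: num_real.
move=> x xC Q _ /=; apply: le_trans (ltW xC); apply: b; exact: SO3_val.
Qed.

Lemma eq_expect phi psi :
  (forall Q, SO3_set Q -> phi Q = psi Q) -> expect phi = expect psi.
Proof.
move=> e; congr Rintegral; apply/funext => Q; apply: e; exact: SO3_val.
Qed.

Lemma expectD phi psi : test_fun phi -> test_fun psi ->
  expect (fun Q => phi Q + psi Q) = expect phi + expect psi.
Proof. by move=> t1 t2; apply: RintegralD => //; exact: test_fun_integrable. Qed.

Lemma expectZ (c : R) phi : test_fun phi ->
  expect (fun Q => c * phi Q) = c * expect phi.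
Proof. by move=> t; apply: RintegralZl => //; exact: test_fun_integrable. Qed.

Lemma expect_cst (c : R) : expect (fun=> c) = c.
Proof.
rewrite /expect; have -> := @Rintegral_cst _ _ _ mu setT measurableT c.
by rewrite [X in fine X]probability_setT mulr1.
Qed.

Lemma expect_sum (I : Type) (r : seq I) (F : I -> 'M[R]_3 -> R) :
  (forall i, test_fun (F i)) ->
  expect (fun Q => \sum_(i <- r) F i Q) = \sum_(i <- r) expect (F i).
Proof.
move=> tF; elim: r => [|i r IH].
  by under eq_fun do rewrite big_nil; rewrite big_nil expect_cst.
under eq_fun do rewrite big_cons.
by rewrite big_cons expectD ?IH //; exact: test_fun_sum.
Qed.

Lemma expect_mull A phi : SO3_set A -> test_fun phi ->
  expect (fun Q => phi (A *m Q)) = expect phi.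
Proof.
move=> SA tphi.
pose g : SO3 R := exist (fun Q => Q \in @SO3_set R) A (mem_set SA).
have mg := SO3_mull_measurable g.
have phiE : forall Q : borelSO3 R, phi (A *m \val (Q : SO3 R)) =
  ((fun Q : borelSO3 R => phi (\val (Q : SO3 R))) \o
   (fun h : borelSO3 R => (g * h)%g : borelSO3 R)) Q by [].
rewrite /expect /Rintegral; congr fine.
have := @integral_pushforward _ _ _ _ _ _ mg mu setT
  (EFin \o (fun Q : borelSO3 R => phi (\val (Q : SO3 R)))).
rewrite preimage_setT => <- //; last 2 first.
- by apply/measurable_EFinP; exact: test_fun_measurable.
- apply: (@test_fun_integrable (fun Q => phi (A *m Q))).
  under eq_fun do rewrite -[A *m _]mulmx1.
  by apply: test_fun_translate => //; exact: SO3_set1.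
apply: eq_measure_integral => U mU _; rewrite /pushforward /=.
(* Invariance is stated for images: the image of U under the inverse of g is the preimage of U under
   g, which is the set that the pushforward measures. *)
rewrite -[RHS](mu_haar (g^-1)%g mU); congr (mu _).
apply/seteqP; split => h /=.
  by move=> Ugh; exists (g * h)%g => //; rewrite mulKg.
by move=> [k Uk <-]; rewrite mulVKg.
Qed.

(* Integrate phi (g^T h) over pairs: integrating h first gives the mean of phi,
   and for fixed h the substitution g := h g turns the inner integral over g
   into the mean of phi (g^T). *)
Lemma expect_tr phi : test_fun phi ->
  expect (fun Q => phi Q^T) = expect phi.
Proof.
move=> tphi; have [mphi [C bphi]] := tphi.
pose f (gh : borelSO3 R * borelSO3 R) :=
  phi ((\val (gh.1 : SO3 R))^T *m \val (gh.2 : SO3 R)).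
have mf : measurable_fun setT f.
  apply: (mphi _ _ (fun gh : borelSO3 R * borelSO3 R =>
    (\val (gh.1 : SO3 R))^T *m \val (gh.2 : SO3 R))).
  apply: mulmx_entry_measurable => i j.
    rewrite (_ : (fun t => _) =
      (fun Q : borelSO3 R => (\val (Q : SO3 R)) j i) \o fst); last first.
      by apply/funext => t; rewrite mxE.
    by apply: measurableT_comp => //; exact: SO3_entry_measurable.
  apply: (@measurableT_comp _ _ _ _ _ _
    (fun Q : borelSO3 R => (\val (Q : SO3 R)) i j)) => //.
  exact: SO3_entry_measurable.
have intf : (mu \x mu)%E.-integrable setT (EFin \o f).
  apply: measurable_bounded_integrable => //.
    rewrite -setXTT; have := @product_measure1E _ _ _ _ _ mu mu _ _
      (@measurableT _ (borelSO3 R)) (@measurableT _ (borelSO3 R)).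
    by move=> /= ->; rewrite !probability_setT mule1 ltry.
  exists C; split; first exact: num_real.
  move=> x xC Q _ /=; apply: le_trans (ltW xC); apply: bphi.
  by apply: SO3_setM; [apply: SO3_setT|]; exact: SO3_val.
have := Fubini intf => /=.
have E1 x : (\int[mu]_y (f (x, y))%:E = (expect phi)%:E)%E.
  rewrite -(expect_mull (SO3_setT (SO3_val x)) tphi) /expect /Rintegral fineK //.
  apply: integrable_fin_num => //.
  apply: (@test_fun_integrable (fun Q => phi ((\val (x : SO3 R))^T *m Q))).
  under eq_fun do rewrite -[_ *m _]mulmx1.
  by apply: test_fun_translate; [apply: SO3_setT; exact: SO3_val|exact: SO3_set1|].
have tT := test_fun_tr tphi.
have E2 y : (\int[mu]_x (f (x, y))%:E = (expect (fun Q => phi Q^T))%:E)%E.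
  rewrite -(expect_mull (SO3_setT (SO3_val y)) tT) /expect /Rintegral fineK.
    by apply: eq_integral => g _; rewrite /f /= trmx_mul trmxK.
  apply: integrable_fin_num => //.
  apply: (@test_fun_integrable (fun Q => phi ((\val (y : SO3 R))^T *m Q)^T)).
  under eq_fun do rewrite -[(_^T *m _)]mulmx1.
  by apply: (@test_fun_translate _ _ _ (fun Q => phi Q^T));
     [apply: SO3_setT; exact: SO3_val|exact: SO3_set1|].
under eq_integral do rewrite E1.
under [X in _ = X -> _]eq_integral do rewrite E2.
by rewrite !integral_cst //= !probability_setT !mule1 => -[].
Qed.

(** Transposition exchanges left and right translations, so [expect_tr] upgrades left invariance to
    invariance on both sides. *)
Lemma expect_translate A B phi : SO3_set A -> SO3_set B -> test_fun phi ->
  expect (fun Q => phi (A *m Q *m B)) = expect phi.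
Proof.
move=> SA SB tphi.
have tB : test_fun (fun Q => phi (Q *m B)).
  under eq_fun do rewrite -[X in X *m B]mul1mx.
  by apply: test_fun_translate => //; exact: SO3_set1.
rewrite (expect_mull SA tB) -(expect_tr tB).
have := expect_mull (SO3_setT SB) (test_fun_tr tphi); rewrite expect_tr //.
by move=> <-; apply: eq_expect => Q _; rewrite trmx_mul trmxK.
Qed.

End haar_expectation.

(** * Moments of a rotating pair *)

Section rotation_moments.
Context {R : realType}.

(** The first [size (p - q)] natural numbers are distinct in R and are roots of p - q, more than a
    nonzero polynomial of that size can have. *)
Lemma poly_horner_inj (p q : {poly R}) : (forall x, p.[x] = q.[x]) -> p = q.
Proof.
move=> e; apply/eqP; rewrite -subr_eq0; apply/eqP.
pose s : seq R := [seq i%:R | i <- iota 0 (size (p - q))].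
apply: (@roots_geq_poly_eq0 _ _ s).
- by apply/allP => x _; rewrite rootE !hornerE e subrr.
- by rewrite map_inj_uniq ?iota_uniq // => i j /eqP; rewrite eqr_nat => /eqP.
- by rewrite size_map size_iota.
Qed.

(** Induction modulo X^3, with the higher terms collected in [r]. *)
Lemma coef2_1DX2_exp (k : nat) : ((1 + 'X^2 : {poly R}) ^+ k)`_2 = k%:R.
Proof.
suff [r ->] : exists r : {poly R}, (1 + 'X^2) ^+ k = 1 + k%:R *: 'X^2 + 'X^3 * r.
  by rewrite !coefE /= mulr0n add0r mulr1 addr0.
elim: k => [|k [r IH]].
  by exists 0; rewrite expr0 scale0r mulr0 !addr0.
exists (r + k%:R *: 'X + 'X^2 * r).
rewrite exprS IH -natr1 scalerDl scale1r -!mul_polyC; ring.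
Qed.

Variable mu : probability (borelSO3 R) R.
Hypothesis mu_haar : is_haar mu.
Implicit Types (p q r h phi : 'M[R]_3 -> R) (A B Q : 'M[R]_3).

(** Common form of three uses of Haar invariance: Q33 against another entry of its column, alpha,
    and beta. The weight [h] carries the factors that the rotation fixes. *)
Definition rotates p q h := forall t, exists A B, [/\ SO3_set A, SO3_set B &
  forall Q, SO3_set Q ->
    p (A *m Q *m B) = cos t * p Q + sin t * q Q /\ h (A *m Q *m B) = h Q].

Lemma rotates_expect p q h n t : test_fun p -> test_fun h -> rotates p q h ->
  expect mu (fun Q => (cos t * p Q + sin t * q Q) ^+ n * h Q) =
  expect mu (fun Q => p Q ^+ n * h Q).
Proof.
move=> tp th /(_ t) [A [B [SA SB rot]]].
have tph : test_fun (fun Q => p Q ^+ n * h Q).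
  by apply: test_funM => //; exact: test_funX.
rewrite -(expect_translate mu_haar SA SB tph).
by apply: eq_expect => Q /rot [-> ->].
Qed.

(** The half turn t = pi sends p to -p, so an odd moment is its own negative. *)
Lemma rotates_odd p q h n : test_fun p -> test_fun h -> rotates p q h ->
  odd n -> expect mu (fun Q => p Q ^+ n * h Q) = 0.
Proof.
move=> tp th rot on; have := rotates_expect n pi tp th rot.
rewrite cospi sinpi.
under eq_expect => Q _ do
  rewrite mul0r addr0 exprMn -signr_odd on expr1 mulN1r mulNr -mulN1r.
rewrite expectZ; last by apply: test_funM => //; exact: test_funX.
by move=> e; lra.
Qed.

(* With t = atan x, invariance says (1 + x^2)^(k+1) E[p^(2k+2) h] =
   E[(p + x q)^(2k+2) h] for every x; the identity compares the coefficients
   of x^2. *)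
Lemma rotates_even p q h k : test_fun p -> test_fun q -> test_fun h ->
  rotates p q h ->
  expect mu (fun Q => p Q ^+ k.*2.+2 * h Q) =
  k.*2.+1%:R * expect mu (fun Q => p Q ^+ k.*2 * q Q ^+ 2 * h Q).
Proof.
move=> tp tq th rot; set n := k.*2.+2; set m := LHS.
pose e i := expect mu (fun Q => p Q ^+ (n - i) * q Q ^+ i * h Q).
have te i : test_fun (fun Q => p Q ^+ (n - i) * q Q ^+ i * h Q).
  by apply: test_funM => //; apply: test_funM; exact: test_funX.
pose P1 := \poly_(i < n.+1) ('C(n, i)%:R * e i).
pose P2 := m *: (1 + 'X^2) ^+ k.+1.
have P12 : P1 = P2.
  apply: poly_horner_inj => x; rewrite horner_poly !hornerE.
  have c2 : cos (atan x) ^+ 2 = (1 + x ^+ 2)^-1.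
    by rewrite cos_atan exprVn sqr_sqrtr // addr_ge0 ?sqr_ge0.
  have x0 : 1 + x ^+ 2 != 0 by rewrite gt_eqF // ltr_wpDr ?sqr_ge0.
  have c0 : cos (atan x) != 0.
    by apply: contra_neq x0 => c0; move: c2; rewrite c0 expr0n => /esym/eqP;
       rewrite invr_eq0 => /eqP.
  have sE : sin (atan x) = x * cos (atan x).
    by rewrite -{2}[x]atanK /tan divfK.
  rewrite /m -(rotates_expect n (atan x) tp th rot).
  have -> : expect mu (fun Q => (cos (atan x) * p Q + sin (atan x) * q Q) ^+ n
      * h Q) = expect mu (fun Q => (1 + x ^+ 2)^-1 ^+ k.+1 *
       \sum_(i < n.+1) (x ^+ i * 'C(n, i)%:R) *
          (p Q ^+ (n - i) * q Q ^+ i * h Q)).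
    apply: eq_expect => Q _; rewrite sE -c2 -exprM mul2n.
    have -> : cos (atan x) * p Q + x * cos (atan x) * q Q =
       cos (atan x) * (p Q + x * q Q) by ring.
    rewrite exprMn -mulrA exprDn; congr (_ * _).
    rewrite mulr_suml; apply: eq_bigr => i _.
    by rewrite exprMn -mulr_natr; ring.
  rewrite expectZ; last by apply: test_fun_sum => i; exact: test_funZ.
  rewrite expect_sum; last by move=> i; exact: test_funZ.
  rewrite mulrAC -exprMn mulVf // expr1n mul1r.
  by apply: eq_bigr => i _; rewrite expectZ // /e; ring.
have /(congr1 (fun P : {poly R} => P`_2)) := P12.
rewrite coef_poly /= coefZ coef2_1DX2_exp /e /n -[(k.*2.+2 - 2)%N]/(k.*2 - 0)%N.
rewrite subn0 bin2 /= => E.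
(* The binomial coefficient n choose 2 is (k+1)(2k+1), and (1 + X^2)^(k+1) contributes k+1 on the
   other side; cancelling k+1 leaves the factor 2k+1. *)
have : (k.*2.+2 * k.*2.+1)./2%:R = k.+1%:R * k.*2.+1%:R :> R.
  by rewrite -doubleS -doubleMl doubleK natrM.
move: E => + E; rewrite {}E => E.
have k0 : k.+1%:R != 0 :> R by rewrite pnatr_eq0.
by apply: (mulIf k0); rewrite -E; ring.
Qed.

(** Each application of [rotates_even] trades p^2 for r^2 at the cost (2l+1)/(2l+2); the product of
    these costs over l < k is (2k)!/(4^k k!^2). The powers of r gained on the way join the weight,
    hence the rotation hypothesis for all weights r^(2j) h. *)
Lemma circle_moment p q r h k :
  test_fun p -> test_fun q -> test_fun r -> test_fun h ->
  (forall j, rotates p q (fun Q => r Q ^+ j.*2 * h Q)) ->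
  (forall Q, SO3_set Q -> p Q ^+ 2 + q Q ^+ 2 = r Q ^+ 2) ->
  expect mu (fun Q => p Q ^+ k.*2 * h Q) / k.*2`!%:R =
  expect mu (fun Q => (r Q / 2) ^+ k.*2 * h Q) / k`!%:R ^+ 2.
Proof.
move=> tp tq tr th rot pqr.
have tX f g n : test_fun f -> test_fun g -> test_fun (fun Q => f Q ^+ n * g Q).
  by move=> tf tg; apply: test_funM => //; exact: test_funX.
(* With a = E[p^(2l+2) w], b = E[p^(2l) q^2 w] and c = E[p^(2l) r^2 w], one has a = (2l+1) b and c =
   a + b, hence a = (2l+1)/(2l+2) c. *)
have step j l : expect mu (fun Q => p Q ^+ l.+1.*2 * (r Q ^+ j.*2 * h Q)) =
    (l.*2.+1%:R / l.*2.+2%:R) *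
    expect mu (fun Q => p Q ^+ l.*2 * (r Q ^+ j.+1.*2 * h Q)).
  have tj := tX _ _ j.*2 tr th.
  have := rotates_even l tp tq tj (rot j).
  set a := expect _ _; set b := expect _ _ => ab; set c := expect mu _.
  have -> : c = a + b.
    rewrite /a /b -expectD; [|exact: tX|].
      apply: eq_expect => Q SQ.
      have -> : p Q ^+ l.*2.+2 = p Q ^+ l.*2 * p Q ^+ 2 by rewrite -exprD addn2.
      by rewrite doubleS -addn2 exprD -pqr //; ring.
    by apply: test_funM => //; apply: test_funM; exact: test_funX.
  rewrite ab.
  rewrite -[l.*2.+2%:R]natr1; have : 0 <= l.*2.+1%:R :> R by [].
  by set x := _%:R => x0; field; rewrite gt_eqF // ltr_wpDl.
(* The exponent j must vary in the induction on k, because each step moves a factor r^2 into the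
   weight. *)
suff gen j : expect mu (fun Q => p Q ^+ k.*2 * (r Q ^+ j.*2 * h Q)) / k.*2`!%:R =
   expect mu (fun Q => (r Q / 2) ^+ k.*2 * (r Q ^+ j.*2 * h Q)) / k`!%:R ^+ 2.
  have := gen 0%N.
  have e0 f : (fun Q => f Q * (r Q ^+ 0.*2 * h Q)) = (fun Q => f Q * h Q).
    by apply/funext => Q; rewrite expr0 mul1r.
  by rewrite !e0.
elim: k j => [|k IH] j.
  by rewrite double0 fact0 expr1n.
rewrite step.
have -> : expect mu (fun Q => (r Q / 2) ^+ k.+1.*2 * (r Q ^+ j.*2 * h Q)) =
  2^-1 ^+ 2 * expect mu (fun Q => (r Q / 2) ^+ k.*2 * (r Q ^+ j.+1.*2 * h Q)).
  rewrite -expectZ.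
    by apply: eq_expect => Q _; rewrite !doubleS !exprS; ring.
  apply: (tX (fun Q => r Q / 2)); last exact: tX.
  by apply: test_funM => //; exact: test_fun_cst.
have k0 : (k.*2)`!%:R != 0 :> R by rewrite pnatr_eq0 -lt0n fact_gt0.
have k1 : k`!%:R != 0 :> R by rewrite pnatr_eq0 -lt0n fact_gt0.
have := IH j.+1; set a := expect _ _; set b := expect _ _ => /(canRL (divfK k0)) ->.
rewrite doubleS !factS !natrM -!muln2 -!natr1 !natrM.
have : 0 <= k%:R :> R by []; set x : R := k%:R => x0.
have [n1 n2 n3] : [/\ x + 1 != 0, x * 2 + 1 != 0 & x * 2 + 1 + 1 != 0].
  by split; apply: lt0r_neq0; lra.
by field; rewrite muln2 k0 k1 n1 n2 n3.
Qed.


End rotation_moments.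

(** * Explicit 3x3 matrices *)

Section three_by_three.
Context {R : realType}.
Implicit Types (A B Q : 'M[R]_3).

Lemma sum_ord3 (V : zmodType) (f : 'I_3 -> V) : \sum_i f i = f 0 + f 1 + f 2.
Proof.
rewrite !big_ord_recr big_ord0 /= add0r.
by congr (f _ + f _ + f _); apply/val_inj.
Qed.

Lemma mulmx3E A B i j :
  (A *m B) i j = A i 0 * B 0 j + A i 1 * B 1 j + A i 2 * B 2 j.
Proof. by rewrite mxE sum_ord3. Qed.

Lemma det_mx22 (A : 'M[R]_2) : \det A = A 0 0 * A 1 1 - A 0 1 * A 1 0.
Proof.
rewrite (expand_det_row _ 0) !big_ord_recr big_ord0 /= add0r /cofactor !det_mx11.
rewrite !mxE /= expr0 expr1 mul1r mulN1r mulrN.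
by congr (A _ _ * A _ _ - A _ _ * A _ _); apply/val_inj.
Qed.

Lemma det_mx33 A : \det A =
  A 0 0 * (A 1 1 * A 2 2 - A 1 2 * A 2 1)
  - A 0 1 * (A 1 0 * A 2 2 - A 1 2 * A 2 0)
  + A 0 2 * (A 1 0 * A 2 1 - A 1 1 * A 2 0).
Proof.
rewrite (expand_det_row _ 0) sum_ord3 /cofactor !det_mx22 !mxE.
have e0 : (lift 0 0 : 'I_3) = 1 by apply/val_inj.
have e1 : (lift 0 1 : 'I_3) = 2 by apply/val_inj.
have e2 : (lift 1 0 : 'I_3) = 0 by apply/val_inj.
have e3 : (lift 1 1 : 'I_3) = 2 by apply/val_inj.
have e4 : (lift 2 0 : 'I_3) = 0 by apply/val_inj.
have e5 : (lift 2 1 : 'I_3) = 1 by apply/val_inj.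
by rewrite e0 e1 e2 e3 e4 e5 /= !addn0 !add0n expr0 expr1 sqrrN expr1n; ring.
Qed.

Definition mx33 (a b c d e f g h k : R) : 'M[R]_3 := \matrix_(i, j)
  nth 0 (nth [::] [:: [:: a; b; c]; [:: d; e; f]; [:: g; h; k]] i) j.

Lemma mx33E a b c d e f g h k : let M := mx33 a b c d e f g h k in
  ((M 0 0 = a) * (M 0 1 = b) * (M 0 2 = c) *
   (M 1 0 = d) * (M 1 1 = e) * (M 1 2 = f) *
   (M 2 0 = g) * (M 2 1 = h) * (M 2 2 = k))%type.
Proof. by rewrite /= /mx33; do ![split]; rewrite mxE. Qed.

(** Splits an index into the literals [0], [1], [2] on which [mx33E] can rewrite. *)
Lemma ord3P (P : 'I_3 -> Prop) : P 0 -> P 1 -> P 2 -> forall i, P i.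
Proof.
move=> P0 P1 P2 [[|[|[|//]]] i3].
- by have -> : Ordinal i3 = 0 by apply/val_inj.
- by have -> : Ordinal i3 = 1 by apply/val_inj.
- by have -> : Ordinal i3 = 2 by apply/val_inj.
Qed.

Lemma SO3_set_mx33 a b c d e f g h k :
  a ^+ 2 + d ^+ 2 + g ^+ 2 = 1 -> b ^+ 2 + e ^+ 2 + h ^+ 2 = 1 ->
  c ^+ 2 + f ^+ 2 + k ^+ 2 = 1 ->
  a * b + d * e + g * h = 0 -> a * c + d * f + g * k = 0 ->
  b * c + e * f + h * k = 0 ->
  a * (e * k - f * h) - b * (d * k - f * g) + c * (d * h - e * g) = 1 ->
  SO3_set (mx33 a b c d e f g h k).
Proof.
move=> e00 e11 e22 e01 e02 e12 dt; split; last by rewrite det_mx33 !mx33E.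
apply/matrixP; apply: ord3P; apply: ord3P;
  rewrite mulmx3E [RHS]mxE !(mxE trmx_key) !mx33E /= ?mulr1n ?mulr0n -?expr2 //.
- by rewrite -e01; ring.
- by rewrite -e02; ring.
- by rewrite -e12; ring.
Qed.

Definition rotz (t : R) :=
  mx33 (cos t) (- sin t) 0 (sin t) (cos t) 0 0 0 1.
(** The signs are opposite to the usual rotation about the second axis: the last row of
    [roty t *m Q] is then cos t times row 2 plus sin t times row 0, the form that [rotates] asks
    for. *)
Definition roty (t : R) :=
  mx33 (cos t) 0 (- sin t) 0 1 0 (sin t) 0 (cos t).
Definition rotx (t : R) :=
  mx33 1 0 0 0 (cos t) (- sin t) 0 (sin t) (cos t).

Lemma SO3_set_rotz t : SO3_set (rotz t).
Proof.
by apply: SO3_set_mx33; have := cos2Dsin2 t; set x := cos t; set y := sin t => e;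
   first [by ring | by rewrite -[RHS]e; ring].
Qed.

Lemma SO3_set_roty t : SO3_set (roty t).
Proof.
by apply: SO3_set_mx33; have := cos2Dsin2 t; set x := cos t; set y := sin t => e;
   first [by ring | by rewrite -[RHS]e; ring].
Qed.

Lemma SO3_set_rotx t : SO3_set (rotx t).
Proof.
by apply: SO3_set_mx33; have := cos2Dsin2 t; set x := cos t; set y := sin t => e;
   first [by ring | by rewrite -[RHS]e; ring].
Qed.

Lemma SO3_set_row_norm Q i : SO3_set Q ->
  Q i 0 ^+ 2 + Q i 1 ^+ 2 + Q i 2 ^+ 2 = 1.
Proof.
move=> [/mulmx1C/matrixP/(_ i i)]; rewrite mulmx3E !(mxE trmx_key) mxE eqxx.
by rewrite -!expr2.
Qed.

Lemma SO3_set_col_norm Q i : SO3_set Q ->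
  Q 0 i ^+ 2 + Q 1 i ^+ 2 + Q 2 i ^+ 2 = 1.
Proof. by move=> /SO3_setT/(SO3_set_row_norm i); rewrite !mxE. Qed.

(** For determinant 1 the adjugate is the inverse, here the transpose; compare the last diagonal
    entries. *)
Lemma SO3_set_minor Q : SO3_set Q -> Q 0 0 * Q 1 1 - Q 0 1 * Q 1 0 = Q 2 2.
Proof.
move=> [QQ dQ].
have : \adj Q = Q^T.
  by rewrite -[LHS]mul1mx -QQ -mulmxA mul_mx_adj dQ mulmx1.
move=> /matrixP/(_ 2 2); rewrite !mxE /cofactor det_mx22 !mxE => <-.
have e4 : (lift 2 0 : 'I_3) = 0 by apply/val_inj.
have e5 : (lift 2 1 : 'I_3) = 1 by apply/val_inj.
by rewrite e4 e5 -signr_odd /= expr0 mul1r.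
Qed.

End three_by_three.

(** * Moments of Q33 and the rotations of alpha and beta *)

Section moments.
Context {R : realType} (mu : probability (borelSO3 R) R).
Hypothesis mu_haar : is_haar mu.
Implicit Types (A B Q : 'M[R]_3) (h : 'M[R]_3 -> R).

(** A left rotation in the plane of axes i and 2 mixes the rows i and 2 of Q, and so these two
    entries of the last column. *)
Lemma rotates_polar (i : 'I_3) : i != 2 ->
  rotates (fun Q : 'M[R]_3 => Q 2 2) (fun Q => Q i 2) (fun=> 1).
Proof.
move=> i2 t; have [A [SA A2]] : exists A, SO3_set A /\
    forall Q, (A *m Q) 2 2 = cos t * Q 2 2 + sin t * Q i 2.
  move: i i2; apply: ord3P => // _; [exists (roty t)|exists (rotx t)]; split.
  - exact: SO3_set_roty.
  - by move=> Q; rewrite mulmx3E !mx33E; ring.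
  - exact: SO3_set_rotx.
  - by move=> Q; rewrite mulmx3E !mx33E; ring.
exists A, 1%:M; split => //; first exact: SO3_set1.
by move=> Q _; rewrite mulmx1 A2.
Qed.

(** Let (x, y, z) be the last column. Rotating z against x gives E[z^(2n+2)] = (2n+1) E[z^(2n) x^2],
    and likewise for y. As x^2 + y^2 + z^2 = 1, summing yields E[z^(2n)] = (2n+3)/(2n+1)
    E[z^(2n+2)]. *)
Lemma polar_moment n :
  expect mu (fun Q => Q 2 2 ^+ n) = if odd n then 0 else n.+1%:R^-1.
Proof.
have tz := @test_fun_entry R.
have t1 := test_fun_cst (1 : R).
have r0 := @rotates_polar 0 isT; have r1 := @rotates_polar 1 isT.
case: ifPn => [on|].
  have := rotates_odd mu_haar (tz 2 2) t1 r0 on.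
  by under eq_expect do rewrite mulr1.
move=> /even_halfK <-; move: n./2 => {}n.
elim: n => [|n IH].
  by under eq_expect do rewrite expr0; rewrite expect_cst invr1.
have := rotates_even mu_haar n (tz 2 2) (tz 0 2) t1 r0.
have := rotates_even mu_haar n (tz 2 2) (tz 1 2) t1 r1.
have e1 (f : 'M[R]_3 -> R) : (fun Q => f Q * 1) = f.
  by apply/funext => Q; rewrite mulr1.
rewrite !e1 doubleS.
have sum : expect mu (fun Q => Q 2 2 ^+ n.*2 * Q 0 2 ^+ 2) +
    (expect mu (fun Q => Q 2 2 ^+ n.*2 * Q 1 2 ^+ 2) +
     expect mu (fun Q => Q 2 2 ^+ n.*2.+2)) = n.*2.+1%:R^-1.
  have tX i k : test_fun (fun Q : 'M[R]_3 => Q i 2 ^+ k) by exact: test_funX.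
  have tM i := test_funM (tX 2 n.*2) (tX i 2%N).
  rewrite -IH -expectD // -expectD //; last exact: test_funD.
  apply: eq_expect => Q SQ; rewrite -[RHS]mulr1 -(SO3_set_col_norm 2 SQ).
  by rewrite !exprS; ring.
move: sum; set a := expect _ _; set b := expect _ _; set c := expect _ _.
rewrite -(natr1 n.*2.+2) -(natr1 n.*2.+1).
have : 0 < n.*2.+1%:R :> R by []; set x : R := n.*2.+1%:R => x0 sum cb ca.
have x1 : x + 1 + 1 != 0 by rewrite lt0r_neq0 // !addr_gt0.
apply: (mulIf x1); rewrite mulVf // mulrDr mulrDr mulr1.
rewrite -[RHS](mulfV (lt0r_neq0 x0)) -sum !mulrDr -ca -cb; ring.
Qed.

(* The upper left 2x2 block of Q acts on the plane, seen as the complex numbers,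
   by v |-> alpha v + beta (conjugate v). *)
Definition re_alpha Q := (Q 0 0 + Q 1 1) / 2.
(** This is minus the imaginary part of alpha, so that turning alpha through t sends its real part
    to cos t [re_alpha] + sin t [im_alpha]. *)
Definition im_alpha Q := (Q 0 1 - Q 1 0) / 2.
Definition re_beta Q := (Q 0 0 - Q 1 1) / 2.
Definition im_beta Q := (Q 0 1 + Q 1 0) / 2.

(** Four times the left side is the squared norm of the 2x2 block plus twice its determinant. The
    unit rows and last column give 1 + Q33^2 for the former, and the determinant is Q33. *)
Lemma norm_alpha Q : SO3_set Q ->
  re_alpha Q ^+ 2 + im_alpha Q ^+ 2 = ((1 + Q 2 2) / 2) ^+ 2.
Proof.
move=> SQ; have m := SO3_set_minor SQ; have := SO3_set_row_norm 0 SQ.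
have := SO3_set_row_norm 1 SQ; have := SO3_set_col_norm 2 SQ.
rewrite /re_alpha /im_alpha => c2 r1 r0.
suff : (Q 0 0 + Q 1 1) ^+ 2 + (Q 0 1 - Q 1 0) ^+ 2 = (1 + Q 2 2) ^+ 2.
  by move=> e; rewrite !expr_div_n -mulrDl e.
have -> : (Q 0 0 + Q 1 1) ^+ 2 + (Q 0 1 - Q 1 0) ^+ 2 =
  (Q 0 0 ^+ 2 + Q 0 1 ^+ 2 + Q 0 2 ^+ 2) + (Q 1 0 ^+ 2 + Q 1 1 ^+ 2 + Q 1 2 ^+ 2)
  - (Q 0 2 ^+ 2 + Q 1 2 ^+ 2 + Q 2 2 ^+ 2) + Q 2 2 ^+ 2
  + 2 * (Q 0 0 * Q 1 1 - Q 0 1 * Q 1 0) by ring.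
by rewrite r0 r1 c2 m; ring.
Qed.

(** |alpha|^2 - |beta|^2 is the determinant of the block, which is Q33. *)
Lemma norm_beta Q : SO3_set Q ->
  re_beta Q ^+ 2 + im_beta Q ^+ 2 = ((1 - Q 2 2) / 2) ^+ 2.
Proof.
move=> SQ; rewrite -[RHS](_ : ((1 + Q 2 2) / 2) ^+ 2 - Q 2 2 = _); last by field.
rewrite -norm_alpha // -[X in _ - X]SO3_set_minor //.
by rewrite /re_alpha /re_beta /im_alpha /im_beta; field.
Qed.

(** Alpha is multiplied by e^(i(x+y)) and beta by e^(i(x-y)), since complex conjugation reverses the
    rotation applied on the right. *)
Lemma rotz_conj x y Q : let M := rotz x *m Q *m rotz y in
  [/\ M 2 2 = Q 2 2,
      re_alpha M = cos (x + y) * re_alpha Q + sin (x + y) * im_alpha Q &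
      re_beta M = cos (x - y) * re_beta Q - sin (x - y) * im_beta Q].
Proof.
rewrite /re_alpha /re_beta /im_alpha /im_beta !cosD !sinD cosN sinN.
rewrite /= !mulmx3E !mx33E; split; first by ring.
- by field.
- by field.
Qed.

(** Equal angles t/2 have sum t and difference 0: beta stays fixed and may occur in the weight. *)
Lemma rotates_alpha (F : R -> R -> R) :
  rotates re_alpha im_alpha (fun Q => F (re_beta Q) (Q 2 2)).
Proof.
move=> t; exists (rotz (t / 2)), (rotz (t / 2)).
split; [exact: SO3_set_rotz|exact: SO3_set_rotz|move=> Q _].
have [-> -> ->] := rotz_conj (t / 2) (t / 2) Q.
by rewrite subrr cos0 sin0 mul1r mul0r subr0 -splitr.
Qed.

(** The angles -t/2 and t/2 have difference -t, which absorbs the minus sign in [rotz_conj]. *)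
Lemma rotates_beta (F : R -> R) :
  rotates re_beta im_beta (fun Q => F (Q 2 2)).
Proof.
move=> t; exists (rotz (- (t / 2))), (rotz (t / 2)).
split; [exact: SO3_set_rotz|exact: SO3_set_rotz|move=> Q _].
have [-> _ ->] := rotz_conj (- (t / 2)) (t / 2) Q.
by rewrite -opprD -splitr cosN sinN mulNr opprK.
Qed.

End moments.

(** * Taylor polynomials and passage to the limit *)

Section truncations.
Context {R : realType}.
Implicit Types (x a : R) (N : nat).

Definition exp_partial N x := series (exp_coeff x) N.

Definition besselI0_partial N x :=
  series (fun r => (x / 2) ^+ (2 * r) / (r`!%:R) ^+ 2) N.

Lemma exp_partialE N x : exp_partial N x = \sum_(i < N) x ^+ i / i`!%:R.
Proof. by rewrite /exp_partial /series /= big_mkord. Qed.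

Lemma besselI0_partialE N x :
  besselI0_partial N x = \sum_(r < N) (x / 2) ^+ r.*2 / r`!%:R ^+ 2.
Proof.
rewrite /besselI0_partial /series /= big_mkord.
by apply: eq_bigr => r _; rewrite mul2n.
Qed.

Lemma exp_partial_ge0_le N x : 0 <= x -> exp_partial N x <= expR x.
Proof.
move=> x0; apply: nondecreasing_cvgn_le; last exact: is_cvg_series_exp_coeff.
by apply: nondecreasing_series => n _ _; exact: exp_coeff_ge0.
Qed.

Lemma exp_partial_bound N x : `|exp_partial N x| <= expR `|x|.
Proof.
apply: le_trans (exp_partial_ge0_le N (normr_ge0 x)).
rewrite !exp_partialE; apply: le_trans (ler_norm_sum _ _ _) _.
by apply: ler_sum => i _; rewrite normrM normrX [`|_^-1|]ger0_norm.
Qed.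

(** The doubled index is that of [circle_exp_partial], where N terms of I0 face 2N terms of the
    exponential. *)
Lemma exp_partial_cvg x : exp_partial N.*2 x @[N --> \oo] --> expR x.
Proof.
apply: (@cvg_comp _ _ _ double (fun N => exp_partial N x) _ \oo).
  move=> P [N _ NP]; exists N => // n /= Nn; apply: NP => /=.
  by rewrite -addnn (leq_trans Nn) ?leq_addr.
exact: is_cvg_series_exp_coeff.
Qed.

(** Since r! <= r!^2, the series of I0 is dominated by the exponential series at (x/2)^2; this
    yields both its convergence and a bound uniform in N. *)
Lemma besselI0_term_le x r :
  0 <= (x / 2) ^+ (2 * r) / (r`!%:R) ^+ 2 <= exp_coeff ((x / 2) ^+ 2) r.
Proof.
have f1 : 1 <= r`!%:R :> R by rewrite ler1n fact_gt0.
have f0 : 0 < r`!%:R :> R by exact: lt_le_trans f1.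
have x0 : 0 <= (x / 2) ^+ (2 * r) by rewrite exprM exprn_ge0 ?sqr_ge0.
rewrite divr_ge0 ?sqr_ge0 //= /exp_coeff /= -exprM ler_wpM2l //.
by rewrite lef_pV2 ?posrE ?exprn_gt0 // expr2 ler_peMl // ltW.
Qed.

Lemma besselI0_partial_bound N x :
  `|besselI0_partial N x| <= expR ((x / 2) ^+ 2).
Proof.
rewrite ger0_norm; last first.
  by apply: sumr_ge0 => r _; have /andP[] := besselI0_term_le x r.
apply: le_trans (exp_partial_ge0_le N (sqr_ge0 _)).
by apply: ler_sum => r _; have /andP[] := besselI0_term_le x r.
Qed.

Lemma besselI0_partial_cvg x : besselI0_partial N x @[N --> \oo] --> besselI0 x.
Proof.
have t r := andP (besselI0_term_le x r).
apply: (@series_le_cvg _ _ (exp_coeff ((x / 2) ^+ 2))) => [r|r|r|].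
- by have [] := t r.
- by rewrite exp_coeff_ge0 ?sqr_ge0.
- by have [] := t r.
- exact: is_cvg_series_exp_coeff.
Qed.

(** Truncated integrands are polynomials in Q33, so moments determine their means. The existential
    gives closure under sums, products and composition without tracking coefficients. *)
Definition is_poly_fun (f : R -> R) := exists P : {poly R}, f =1 horner P.

Lemma is_poly_fun_cst a : is_poly_fun (fun=> a).
Proof. by exists a%:P => x; rewrite hornerC. Qed.

Lemma is_poly_fun_id : is_poly_fun id.
Proof. by exists 'X => x; rewrite hornerX. Qed.

Lemma is_poly_funD f g :
  is_poly_fun f -> is_poly_fun g -> is_poly_fun (fun x => f x + g x).
Proof. by move=> [P fP] [S gS]; exists (P + S) => x; rewrite fP gS hornerD. Qed.

Lemma is_poly_funM f g :
  is_poly_fun f -> is_poly_fun g -> is_poly_fun (fun x => f x * g x).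
Proof. by move=> [P fP] [S gS]; exists (P * S) => x; rewrite fP gS hornerM. Qed.

Lemma is_poly_fun_comp f g :
  is_poly_fun f -> is_poly_fun g -> is_poly_fun (fun x => f (g x)).
Proof.
by move=> [P fP] [S gS]; exists (P \Po S) => x; rewrite fP gS horner_comp.
Qed.

Lemma exp_partial_poly N : is_poly_fun (exp_partial N).
Proof.
exists (\poly_(i < N) (i`!%:R)^-1) => x; rewrite horner_poly exp_partialE.
by apply: eq_bigr => i _; rewrite mulrC.
Qed.

Lemma besselI0_partial_poly N : is_poly_fun (besselI0_partial N).
Proof.
exists (\sum_(r < N) (r`!%:R ^+ 2)^-1 *: (2^-1 *: 'X) ^+ r.*2) => x.
rewrite besselI0_partialE horner_sum; apply: eq_bigr => r _.
by rewrite hornerZ horner_exp hornerZ hornerX mulrC [x / 2]mulrC.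
Qed.

Lemma Rintegral_horner (P : {poly R}) (a b : R) : a < b ->
  \int[lebesgue_measure]_(u in `[a, b]) P.[u] =
  \sum_(i < size P) P`_i / i.+1%:R * (b ^+ i.+1 - a ^+ i.+1).
Proof.
(* [S] is the termwise antiderivative of P. *)
move=> ab; pose S : {poly R} := \sum_(i < size P) (P`_i / i.+1%:R) *: 'X^(i.+1).
have dS : S^`() = P.
  rewrite /S raddf_sum /= -[RHS]coefK poly_def; apply: eq_bigr => i _.
  by rewrite derivZ derivXn -scalerMnr scalerMnl -mulr_natr divfK ?pnatr_eq0.
rewrite /Rintegral (@continuous_FTC2 _ _ (horner S)) //.
- rewrite -EFinB /= !horner_sum -sumrB; apply: eq_bigr => i _.
  by rewrite !hornerZ !hornerXn mulrBr.
- exact/continuous_subspaceT/continuous_horner.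
- split => [x _||]; first exact: derivable_horner.
  + exact/cvg_at_right_filter/continuous_horner.
  + exact/cvg_at_left_filter/continuous_horner.
- by move=> x _; rewrite -derivE dS.
Qed.

Lemma bounded_cvg_Rintegral d (T : measurableType d)
    (nu : {measure set T -> \bar R}) (D : set T) (f_ : nat -> T -> R) (f : T -> R)
    (C : R) : measurable D -> (nu D < +oo)%E ->
  (forall n, measurable_fun D (f_ n)) ->
  (forall t, D t -> f_ n t @[n --> \oo] --> f t) ->
  (forall n t, D t -> `|f_ n t| <= C) ->
  \int[nu]_(t in D) f_ n t @[n --> \oo] --> \int[nu]_(t in D) f t.
Proof.
move=> mD nuD mf_ cf bf.
have mf : measurable_fun D f by exact: measurable_fun_cvg mf_ cf.
have [] := @dominated_convergence _ _ _ nu D mD (fun n => EFin \o f_ n)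
  (EFin \o f) (EFin \o cst C).
- by move=> n; exact/measurable_EFinP.
- exact/measurable_EFinP.
- by apply: aeW => x Dx; apply: cvg_EFin; [exact: nearW|exact: cf].
- apply: measurable_bounded_integrable => //.
  by exists `|C|; split => [|M CM x _ /=]; [exact: num_real|exact: ltW].
- by apply: aeW => x n Dx; rewrite lee_fin; exact: bf.
move=> intf _ cvgI; apply: fine_cvg.
by rewrite fineK //; exact: integrable_fin_num.
Qed.

End truncations.

(** * The integral formula *)

Section fisher.
Context {R : realType} (mu : probability (borelSO3 R) R).
Hypothesis mu_haar : is_haar mu.
Implicit Types (A B Q : 'M[R]_3) (p q r h : 'M[R]_3 -> R).

(** Termwise comparison: odd powers of p have mean 0, and the power 2k gives the k-th term of I0 by
    [circle_moment]. *)
Lemma circle_exp_partial p q r h (a : R) N :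
  test_fun p -> test_fun q -> test_fun r -> test_fun h ->
  (forall j, rotates p q (fun Q => r Q ^+ j.*2 * h Q)) ->
  (forall Q, SO3_set Q -> p Q ^+ 2 + q Q ^+ 2 = r Q ^+ 2) ->
  expect mu (fun Q => exp_partial N.*2 (a * p Q) * h Q) =
  expect mu (fun Q => besselI0_partial N (a * r Q) * h Q).
Proof.
move=> tp tq tr th rot pqr.
have rot0 : rotates p q h.
  by have := rot 0%N; under eq_fun do rewrite expr0 mul1r.
have tX f n : test_fun f -> test_fun (fun Q => f Q ^+ n * h Q).
  by move=> tf; apply: test_funM => //; exact: test_funX.
have -> : (fun Q => exp_partial N.*2 (a * p Q) * h Q) =
    fun Q => \sum_(i < N.*2) (a ^+ i / i`!%:R) * (p Q ^+ i * h Q).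
  apply/funext => Q; rewrite exp_partialE mulr_suml; apply: eq_bigr => i _.
  by rewrite exprMn; ring.
have -> : (fun Q => besselI0_partial N (a * r Q) * h Q) =
    fun Q => \sum_(k < N) (a ^+ k.*2 / k`!%:R ^+ 2) * ((r Q / 2) ^+ k.*2 * h Q).
  apply/funext => Q; rewrite besselI0_partialE mulr_suml; apply: eq_bigr => i _.
  by rewrite -mulrA exprMn; ring.
have tr2 : test_fun (fun Q => r Q / 2).
  by apply: test_funM => //; exact: test_fun_cst.
rewrite !expect_sum; [|by move=> k; apply: test_funZ; exact: tX
                      |by move=> k; apply: test_funZ; exact: tX].
under eq_bigr do rewrite (expectZ _ _ (tX _ _ tp)).
under [RHS]eq_bigr do rewrite (expectZ _ _ (tX _ _ tr2)).
elim: N => [|N IH]; first by rewrite !big_ord0.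
rewrite doubleS !big_ord_recr /= IH.
(* Passing from N to N+1 adds the powers 2N and 2N+1 on the left; the second vanishes. *)
rewrite [X in _ + _ * X](rotates_odd mu_haar tp th rot0) /= ?odd_double //.
rewrite mulr0 addr0.
congr (_ + _); have := circle_moment mu_haar N tp tq tr th rot pqr.
by move=> e; rewrite -!mulrA ![_^-1 * _]mulrC e.
Qed.

Lemma expect_poly_polar (f : R -> R) : is_poly_fun f ->
  expect mu (fun Q => f (Q 2 2)) =
  \int[lebesgue_measure]_(u in `[-1, 1]) (2^-1 * f u).
Proof.
move=> [P fP].
have -> : (fun u => 2^-1 * f u) = horner (2^-1 *: P).
  by apply/funext => u; rewrite fP hornerZ.
rewrite Rintegral_horner; last by rewrite gtrN.
have -> : (fun Q => f (Q 2 2)) =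
    fun Q : 'M[R]_3 => \sum_(i < size P) P`_i * Q 2 2 ^+ i.
  by apply/funext => Q; rewrite fP horner_coef.
have tz i : test_fun (fun Q : 'M[R]_3 => Q 2 2 ^+ i).
  by apply: test_funX; exact: test_fun_entry.
rewrite expect_sum; last by move=> i; exact: test_funZ.
rewrite size_scale ?invr_eq0 ?pnatr_eq0 //; apply: eq_bigr => i _.
rewrite expectZ // polar_moment // coefZ expr1n -signr_odd /=.
(* Over [-1, 1] an odd power integrates to 0 and an even power u^i to 2/(i+1); the density 1/2
   cancels the 2. *)
case: (odd i) => /=; first by rewrite expr0 subrr !mulr0.
by rewrite expr1 opprK; field.
Qed.

Lemma test_fun_poly (f : R -> R) p :
  is_poly_fun f -> test_fun p -> test_fun (fun Q => f (p Q)).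
Proof.
move=> [P fP] tp; under eq_fun do rewrite fP horner_coef.
by apply: test_fun_sum => i; apply: test_funZ; exact: test_funX.
Qed.

Lemma is_poly_funZ (c : R) f : is_poly_fun f -> is_poly_fun (fun u => c * f u).
Proof. by apply: is_poly_funM; exact: is_poly_fun_cst. Qed.

Lemma test_fun_re_alpha : test_fun (@re_alpha R).
Proof.
by apply: test_funM; [apply: test_funD; exact: test_fun_entry|exact: test_fun_cst].
Qed.

Lemma test_fun_im_alpha : test_fun (@im_alpha R).
Proof.
apply: test_funM; last exact: test_fun_cst.
by apply: test_funD; [|apply: test_funN]; exact: test_fun_entry.
Qed.

Lemma test_fun_re_beta : test_fun (@re_beta R).
Proof.
apply: test_funM; last exact: test_fun_cst.
by apply: test_funD; [|apply: test_funN]; exact: test_fun_entry.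
Qed.

Lemma test_fun_im_beta : test_fun (@im_beta R).
Proof.
by apply: test_funM; [apply: test_funD; exact: test_fun_entry|exact: test_fun_cst].
Qed.

Lemma is_poly_fun_1D2 : is_poly_fun (fun u : R => (1 + u) / 2).
Proof.
apply: is_poly_funM; last exact: is_poly_fun_cst.
by apply: is_poly_funD; [exact: is_poly_fun_cst|exact: is_poly_fun_id].
Qed.

Lemma is_poly_fun_1B2 : is_poly_fun (fun u : R => (1 - u) / 2).
Proof.
apply: is_poly_funM; last exact: is_poly_fun_cst.
apply: is_poly_funD; first exact: is_poly_fun_cst.
by have := is_poly_funZ (-1) is_poly_fun_id; under eq_fun do rewrite mulN1r.
Qed.

Lemma exp_partialZ_poly N (c : R) f :
  is_poly_fun f -> is_poly_fun (fun u => exp_partial N (c * f u)).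
Proof.
move=> pf; apply: is_poly_fun_comp; first exact: exp_partial_poly.
exact: is_poly_funZ.
Qed.

Lemma besselI0_partialZ_poly N (c : R) f :
  is_poly_fun f -> is_poly_fun (fun u => besselI0_partial N (c * f u)).
Proof.
move=> pf; apply: is_poly_fun_comp; first exact: besselI0_partial_poly.
exact: is_poly_funZ.
Qed.

Lemma polar_integrand_poly N (a b s : R) : is_poly_fun (fun u =>
  besselI0_partial N (b * ((1 - u) / 2)) *
  (besselI0_partial N (a * ((1 + u) / 2)) * exp_partial N.*2 (s * u))).
Proof.
apply: is_poly_funM.
  by apply: besselI0_partialZ_poly; exact: is_poly_fun_1B2.
apply: is_poly_funM; last exact: exp_partialZ_poly is_poly_fun_id.
by apply: besselI0_partialZ_poly; exact: is_poly_fun_1D2.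
Qed.

(** The order matters: alpha is eliminated first, with the beta factor in the weight; what remains
    depends on beta and Q33, then on Q33 alone. *)
Lemma expect_exp_partial (a b s : R) N :
  expect mu (fun Q => exp_partial N.*2 (a * re_alpha Q) *
    (exp_partial N.*2 (b * re_beta Q) * exp_partial N.*2 (s * Q 2 2))) =
  \int[lebesgue_measure]_(u in `[-1, 1]) (2^-1 *
    (besselI0_partial N (b * ((1 - u) / 2)) *
     (besselI0_partial N (a * ((1 + u) / 2)) * exp_partial N.*2 (s * u)))).
Proof.
have ta := test_fun_re_alpha; have ta' := test_fun_im_alpha.
have tb := test_fun_re_beta; have tb' := test_fun_im_beta.
have pp := is_poly_fun_1D2; have pm := is_poly_fun_1B2.
have pid := @is_poly_fun_id R.
have tz := @test_fun_entry R 2 2.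
rewrite (@circle_exp_partial _ (@im_alpha R) (fun Q => (1 + Q 2 2) / 2)) //;
  first last.
- exact: norm_alpha.
- move=> j; apply: (rotates_alpha (fun v u => ((1 + u) / 2) ^+ j.*2 *
    (exp_partial N.*2 (b * v) * exp_partial N.*2 (s * u)))).
- apply: test_funM; first by apply: (test_fun_poly (exp_partialZ_poly _ b pid)).
  exact: (test_fun_poly (exp_partialZ_poly _ s pid)).
- exact: (test_fun_poly pp tz).
under eq_fun do rewrite mulrCA.
rewrite (@circle_exp_partial _ (@im_beta R) (fun Q => (1 - Q 2 2) / 2)) //;
  first last.
- exact: norm_beta.
- move=> j; apply: (rotates_beta (fun u => ((1 - u) / 2) ^+ j.*2 *
    (besselI0_partial N (a * ((1 + u) / 2)) * exp_partial N.*2 (s * u)))).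
- apply: test_funM; first exact: (test_fun_poly (besselI0_partialZ_poly _ a pp) tz).
  exact: (test_fun_poly (exp_partialZ_poly _ s pid)).
- exact: (test_fun_poly pm tz).
exact: expect_poly_polar (polar_integrand_poly N a b s).
Qed.

Lemma expect_expR (a b s : R) :
  expect mu (fun Q => expR (a * re_alpha Q) *
    (expR (b * re_beta Q) * expR (s * Q 2 2))) =
  \int[lebesgue_measure]_(u in `[-1, 1]) (2^-1 *
    (besselI0 (b * ((1 - u) / 2)) * (besselI0 (a * ((1 + u) / 2)) * expR (s * u)))).
Proof.
set f := (X in expect _ X); set g := (X in Rintegral _ _ X).
pose f_ N Q := exp_partial N.*2 (a * re_alpha Q) *
    (exp_partial N.*2 (b * re_beta Q) * exp_partial N.*2 (s * Q 2 2)).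
pose g_ N u := 2^-1 * (besselI0_partial N (b * ((1 - u) / 2)) *
    (besselI0_partial N (a * ((1 + u) / 2)) * exp_partial N.*2 (s * u))).
have ta := test_fun_re_alpha; have tb := test_fun_re_beta.
have tz := @test_fun_entry R 2 2.
have te N c p : test_fun p -> test_fun (fun Q => exp_partial N.*2 (c * p Q)).
  move=> tp; apply: (test_fun_poly (exp_partial_poly N.*2)).
  exact: test_funZ.
have expM c y : `|y| <= 1 -> expR `|c * y| <= expR `|c|.
  by move=> y1; rewrite ler_expR normrM ler_piMr.
have cf : expect mu (f_ N) @[N --> \oo] --> expect mu f.
  apply: (@bounded_cvg_Rintegral _ _ _ mu setT
    (fun N (Q : borelSO3 R) => f_ N (\val (Q : SO3 R)))
    (fun Q : borelSO3 R => f (\val (Q : SO3 R)))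
    (expR `|a| * (expR `|b| * expR `|s|))) => //.
  - by rewrite (le_lt_trans (probability_le1 _ _)) ?ltry.
  - move=> N; apply: test_fun_measurable.
    by apply: test_funM; [exact: te|apply: test_funM; exact: te].
  - by move=> Q _; apply: cvgM; [|apply: cvgM]; exact: exp_partial_cvg.
  - move=> N Q _; have SQ := SO3_val Q; have e1 i j := SO3_set_entry i j SQ.
    (* [re_alpha] and [re_beta] are half of a sum or difference of two entries, hence bounded by 1
       as Q33 is. *)
    have e2 x y : `|x| <= 1 -> `|y| <= 1 -> `|(x + y) / 2| <= 1 :> R.
      move=> x1 y1; rewrite normrM [`|2^-1|]ger0_norm // ler_pdivrMr // mul1r.
      by apply: le_trans (ler_normD _ _) _; rewrite lerD.
    rewrite !normrM ler_pM ?mulr_ge0 //.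
      apply: le_trans (exp_partial_bound _ _) _; apply: expM; exact: e2.
    rewrite ler_pM //; apply: le_trans (exp_partial_bound _ _) _; apply: expM => //.
    by apply: e2; rewrite ?normrN.
have cg : \int[lebesgue_measure]_(u in `[-1, 1]) g_ N u @[N --> \oo] -->
          \int[lebesgue_measure]_(u in `[-1, 1]) g u.
  apply: (@bounded_cvg_Rintegral _ _ _ lebesgue_measure _ g_ g
    (2^-1 * (expR (b ^+ 2) * (expR (a ^+ 2) * expR `|s|)))) => //.
  - by rewrite /= lebesgue_measure_itv /=; case: ifP => // _; rewrite -EFinB ltry.
  - move=> N; have [P gP] := is_poly_funZ 2^-1 (polar_integrand_poly N a b s).
    rewrite (_ : g_ N = horner P); last exact/funext.
    apply: measurable_funTS; apply: continuous_measurable_fun.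
    exact: continuous_horner.
  - move=> u _; apply: cvgMr; apply: cvgM; first exact: besselI0_partial_cvg.
    by apply: cvgM; [exact: besselI0_partial_cvg|exact: exp_partial_cvg].
  - move=> N u /=; rewrite in_itv /= => /andP[u1 u2].
    (* Applied to y = 1 - u and y = 1 + u, which lie in [0, 2]; then y/4 <= 1 bounds the Bessel
       factors uniformly in u and N. *)
    have e2 c y : 0 <= y <= 2 -> expR ((c * (y / 2) / 2) ^+ 2) <= expR (c ^+ 2).
      move=> /andP[y0 y2]; rewrite ler_expR -mulrA exprMn ler_piMr ?sqr_ge0 //.
      by rewrite exprn_ile1 ?divr_ge0 // !ler_pdivrMr //; lra.
    rewrite !normrM [`|2^-1|]ger0_norm // ler_wpM2l //.
    rewrite ler_pM ?mulr_ge0 //.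
      by apply: le_trans (besselI0_partial_bound _ _) _; apply: e2; lra.
    rewrite ler_pM //.
      by apply: le_trans (besselI0_partial_bound _ _) _; apply: e2; lra.
    apply: le_trans (exp_partial_bound _ _) _; apply: expM.
    by rewrite ler_norml u1.
have fg : (fun N => expect mu (f_ N)) =
          (fun N => \int[lebesgue_measure]_(u in `[-1, 1]) g_ N u).
  by apply/funext => N; exact: expect_exp_partial.
by move: cf; rewrite fg => cf; exact: (cvg_unique _ cf cg).
Qed.

End fisher.

(** * Reduction of c(F) to c(S) and the three cyclic forms *)

Section fisher_const.
Context {R : realType} (mu : probability (borelSO3 R) R).
Hypothesis mu_haar : is_haar mu.
Implicit Types (A Q U V : 'M[R]_3).

Lemma test_fun_fisher A : test_fun (fun Q => expR (\tr (A^T *m Q))).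
Proof.
apply: test_fun_expR; apply: test_fun_sum => i.
under eq_fun do rewrite mxE.
by apply: test_fun_sum => j; apply: test_funZ; exact: test_fun_entry.
Qed.

Lemma fisher_constE A :
  fisher_const mu A = expect mu (fun Q => expR (\tr (A^T *m Q))).
Proof. by []. Qed.

(** Cyclicity of the trace moves V to the right of Q, and the two-sided translation from Q to U^T Q
    V preserves the mean. *)
Lemma fisher_const_svd A U V : SO3_set U -> SO3_set V ->
  fisher_const mu (U *m A *m V^T) = fisher_const mu A.
Proof.
move=> SU SV; rewrite !fisher_constE.
rewrite -(expect_translate mu_haar (SO3_setT SU) SV (test_fun_fisher A)).
apply: eq_expect => Q _; congr expR.
by rewrite !trmx_mul trmxK -[in LHS]mulmxA mxtrace_mulC !mulmxA.
Qed.

Lemma fisher_const_diag (s : 'rV[R]_3) : fisher_const mu (diag_mx s) =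
  \int[lebesgue_measure]_(u in `[-1, 1])
    (2^-1 * besselI0 (2^-1 * (s 0 0 - s 0 1) * (1 - u))
          * besselI0 (2^-1 * (s 0 0 + s 0 1) * (1 + u))
          * expR (s 0 2 * u)).
Proof.
rewrite fisher_constE; transitivity (expect mu (fun Q =>
    expR ((s 0 0 + s 0 1) * re_alpha Q) *
    (expR ((s 0 0 - s 0 1) * re_beta Q) * expR (s 0 2 * Q 2 2)))).
  apply: eq_expect => Q _; rewrite -!expRD; congr expR.
  (* The first two diagonal entries of Q are [re_alpha] + [re_beta] and [re_alpha] - [re_beta],
     which produces the coefficients s1 + s2 and s1 - s2. *)
  rewrite tr_diag_mx /mxtrace sum_ord3 mul_diag_mx !mxE /re_alpha /re_beta.
  by field.
rewrite expect_expR //; congr Rintegral; apply/funext => u.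
by rewrite !mulrA; congr (_ * besselI0 _ * besselI0 _ * _); ring.
Qed.

(* A cyclic permutation matrix lies in SO(3), so reordering the singular values
   is a special case of fisher_const_svd. *)
Lemma fisher_const_cyclic (s : 'rV[R]_3) (i j k : 'I_3) :
  (i, j, k) \in [:: (0, 1, 2); (1, 2, 0); (2, 0, 1)] ->
  fisher_const mu (diag_mx s) =
  fisher_const mu (diag_mx (\row_l nth 0 [:: s 0 i; s 0 j; s 0 k] l)).
Proof.
rewrite !inE => /or3P[] /eqP[-> -> ->].
- congr (fisher_const _ (diag_mx _)); apply/rowP.
  by apply: ord3P; rewrite mxE.
(* Row l of P is the basis vector of the slot that holds the l-th entry of s in the permuted list,
   so conjugating by P restores the original order. *)
- pose P : 'M[R]_3 := mx33 0 0 1 1 0 0 0 1 0.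
  have SP : SO3_set P by apply: SO3_set_mx33; ring.
  rewrite -[RHS](fisher_const_svd _ SP SP); congr fisher_const.
  apply/matrixP; apply: ord3P; apply: ord3P;
  by rewrite !mulmx3E !(mxE trmx_key) !mx33E !mxE /=; ring.
- pose P : 'M[R]_3 := mx33 0 1 0 0 0 1 1 0 0.
  have SP : SO3_set P by apply: SO3_set_mx33; ring.
  rewrite -[RHS](fisher_const_svd _ SP SP); congr fisher_const.
  apply/matrixP; apply: ord3P; apply: ord3P;
  by rewrite !mulmx3E !(mxE trmx_key) !mx33E !mxE /=; ring.
Qed.

End fisher_const.

Theorem proposition1 (R : realType) (mu : probability (borelSO3 R) R)
    (mu_haar : is_haar mu)
    (F : 'M[R]_3) (F_det : 0 < \det F)
    (U V : 'M[R]_3) (U_SO3 : SO3_set U) (V_SO3 : SO3_set V)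
    (s : 'rV[R]_3) (s_gt0 : forall i : 'I_3, 0 < s 0 i)
    (F_svd : F = U *m diag_mx s *m V^T) :
  fisher_const mu F = fisher_const mu (diag_mx s) /\
  forall i j k : 'I_3, (i, j, k) \in [:: (0, 1, 2); (1, 2, 0); (2, 0, 1)] ->
    fisher_const mu (diag_mx s) =
      \int[lebesgue_measure]_(u in `[-1, 1])
        (2^-1 * besselI0 (2^-1 * (s 0 i - s 0 j) * (1 - u))
              * besselI0 (2^-1 * (s 0 i + s 0 j) * (1 + u))
              * expR (s 0 k * u)).
Proof.
split; first by rewrite F_svd fisher_const_svd.
move=> i j k /(fisher_const_cyclic mu_haar s) ->.
by rewrite fisher_const_diag // !mxE.
Qed.
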